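(* Assume that $\mathcal{L}$ has a saddle point $(\xi^*,y^* )\in Z\times Y$. Let $\tau>0$, $\sigma>0$ and $0<\theta\le 1$ satisfy $$\max\left\{\frac{1}{\tau\tilde\gamma+1},\frac{1}{\sigma\tilde\delta+1}\right\}\le\theta\le\frac{1}{L_K^2\tau\sigma},$$ and let $(\xi_n,y_n)_n$ be generated by the algorithm with overrelaxation on the dual variable described in the context. Then, for any $\omega$ such that $$\max\left\{\frac{\theta+1}{\tau\tilde\gamma+2},\frac{1}{\sigma\tilde\delta+1}\right\}\le\omega\le\theta,$$ the following hold. (i) For any $N\in\mathbb{N}$ and any $(\xi,y)\in Z\times Y$, $$(1-\omega L_K^2\tau\sigma)\frac{1}{2\tau}\|\xi_N-\xi\|^2+\frac{1}{2\sigma}\|y_N-y\|^2+\sum_{n=1}^N\frac{\omega^N}{\omega^{n-1}}\big(\mathcal{L}(\xi_n;y)-\mathcal{L}(\xi;y_n)\big)\le\frac{\omega^N}{2\tau}\|\xi_0-\xi\|^2+\frac{\omega^N}{2\sigma}\|y_0-y\|^2.$$ (ii) For $N\ge1$ define $$T_N:=\sum_{n=1}^N\frac{1}{\omega^{n-1}}=\frac{1-\omega^N}{\omega^{N-1}(1-\omega)},\qquad \Xi_N:=\frac{1}{T_N}\sum_{n=1}^N\frac{1}{\omega^{n-1}}\,\xi_n,\qquad Y_N:=\frac{1}{T_N}\sum_{n=1}^N\frac{1}{\omega^{n-1}}\,y_n.$$ Then for any $(\xi,y)\in Z\times Y$, $$\frac{1-\omega}{\omega(1-\omega^N)}(1-\omega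 L_K^2\tau\sigma)\frac{1}{2\tau}\|\xi-\xi_N\|^2+\frac{1-\omega}{\omega(1-\omega^N)}\frac{1}{2\sigma}\|y-y_N\|^2+\mathcal{L}(\Xi_N;y)-\mathcal{L}(\xi;Y_N)\le\frac{1}{T_N}\frac{1}{2\tau}\|\xi-\xi_0\|^2+\frac{1}{T_N}\frac{1}{2\sigma}\|y-y_0\|^2.$$ If $\omega=1$, then $T_N$ is understood as $N$ and $\frac{1-\omega}{\omega(1-\omega^N)}$ as its limit value $\frac1N$.
   Context: $Z$ and $Y$ are finite-dimensional real Hilbert spaces; $K:Z\to Y$ is a linear operator with adjoint $K^*$ and operator norm $L_K=\|K\|>0$. $G:Z\to\mathbb{R}\cup\{+\infty\}$ and $H:Y\to\mathbb{R}\cup\{+\infty\}$ are proper, convex and lower semicontinuous; $H^*$ is the convex conjugate of $H$. $G$ is $\tilde\gamma$-strongly convex and $H^*$ is $\tilde\delta$-strongly convex, with $\tilde\gamma,\tilde\delta>0$ (a function $F$ is $\alpha$-strongly convex if $F(x_2)\ge F(x_1)+\langle p,x_2-x_1\rangle+\frac{\alpha}{2}\|x_2-x_1\|^2$ for all $x_1,x_2$ and $p\in\partial F(x_1)$). $\mathcal{L}(\xi;y):=G(\xi)+\langle K\xi,y\rangle-H^*(y)$ for $(\xi,y)\in Z\times Y$. A saddle point of $\mathcal{L}$ is a solution $(\xi^*,y^* )$ of $\min_{\xi\in Z}\sup_{y\in Y}\mathcal{L}(\xi;y)$ with $\mathcal{L}(\xi^*;y)\le\mathcal{L}(\xi^*;y^*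 )\le\mathcal{L}(\xi;y^* )$ for all $(\xi,y)$. For proper convex lower semicontinuous $F$ and $t>0$, $\mathrm{prox}_{tF}(v)=\arg\min_u\{F(u)+\frac{1}{2t}\|u-v\|^2\}$. Algorithm (overrelaxation on the dual variable): given $\xi_0\in Z$, $y_0\in Y$ and $\bar y_0=y_0$, for $n\ge 0$, $$\xi_{n+1}=\mathrm{prox}_{\tau G}(\xi_n-\tau K^*\bar y_n),\quad y_{n+1}=\mathrm{prox}_{\sigma H^*}(y_n+\sigma K\xi_{n+1}),\quad \bar y_{n+1}=y_{n+1}+\theta(y_{n+1}-y_n).$$ *)

(* Defs.v *)
From HB Require Import structures.
From mathcomp Require Import all_boot all_order all_algebra.
From mathcomp Require Import all_classical all_reals all_analysis.

Set Implicit Arguments.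
Unset Strict Implicit.
Unset Printing Implicit Defensive.

Import Order.TTheory GRing.Theory Num.Theory.
Import numFieldNormedType.Exports.

Local Open Scope classical_set_scope.
Local Open Scope ring_scope.

(* Finite-dimensional real Hilbert spaces: the topology and the norm are those
   of the underlying normed module, tied to the inner product by sqr_normE.
   Completeness is automatic in finite dimension. *)
HB.mixin Record NormedVector_isHilbert (R : realType) (V : Type)
    & NormedModule R V & Vector R V := {
  inner : {dot V for (@idfun R)} ;
  sqr_normE : forall x : V, `|x| ^+ 2 = inner x x
}.

#[short(type="finHilbertType")]
HB.structure Definition FinHilbert (R : realType) :=
  {V of NormedVector_isHilbert R V & NormedModule R V & Vector R V}.

Section operators.
Context {R : realType} {Z Y : finHilbertType R}.

Definition is_adjoint (K : {linear Z -> Y}) (Ks : {linear Y -> Z}) :=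
  forall z y, inner (K z) y = inner z (Ks y).

Definition opnorm (K : {linear Z -> Y}) : R :=
  sup [set `|K z| | z in [set z : Z | `|z| <= 1]].

End operators.

Definition argmin {R : realType} {T : Type} (f : T -> \bar R) : set T :=
  [set u | forall w, (f u <= f w)%E].

Section convex_analysis.
Context {R : realType} {V : finHilbertType R}.
Local Open Scope ereal_scope.

Definition proper_efun (F : V -> \bar R) :=
  (forall x, F x != -oo) /\ exists x, F x != +oo.

Definition convex_efun (F : V -> \bar R) := forall (x y : V) (t : R),
  (0 <= t <= 1)%R ->
  F (t *: x + (1 - t) *: y)%R <= t%:E * F x + (1 - t)%:E * F y.

Definition conjugate (F : V -> \bar R) (p : V) : \bar R :=
  ereal_sup [set (inner p x)%:E - F x | x in [set: V]].

Definition subdifferential (F : V -> \bar R) (x : V) : set V :=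
  [set p | forall z, F x + (inner p (z - x)%R)%:E <= F z].

Definition strongly_convex (a : R) (F : V -> \bar R) :=
  forall x1 x2 p, subdifferential F x1 p ->
  F x1 + (inner p (x2 - x1)%R)%:E + (a / 2 * `|x2 - x1| ^+ 2)%:E <= F x2.

(* As a set; it is a singleton when t > 0 and F is proper, convex and lower
   semicontinuous. *)
Definition prox (t : R) (F : V -> \bar R) (v : V) : set V :=
  argmin (fun u => F u + ((2 * t)^-1 * `|u - v| ^+ 2)%:E).

End convex_analysis.

Section saddle_point.
Context {R : realType} {Z Y : finHilbertType R}.
Local Open Scope ereal_scope.

(* Since +oo - +oo = -oo in \bar R, the value is -oo when G xi = +oo and
   conjugate H y = +oo. *)
Definition lagrangian (K : {linear Z -> Y}) (G : Z -> \bar R) (H : Y -> \bar R)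
    (xi : Z) (y : Y) : \bar R :=
  G xi + (inner (K xi) y)%:E - conjugate H y.

Definition saddle_point (L : Z -> Y -> \bar R) (xis : Z) (ys : Y) :=
  argmin (fun xi => ereal_sup [set L xi y | y in [set: Y]]) xis /\
  forall xi y, L xis y <= L xis ys <= L xi ys.

End saddle_point.

Definition primal_dual_iterates {R : realType} {Z Y : finHilbertType R}
    (K : {linear Z -> Y}) (Ks : {linear Y -> Z})
    (G : Z -> \bar R) (H : Y -> \bar R) (tau sigma theta : R)
    (xi : nat -> Z) (y ybar : nat -> Y) :=
  ybar 0%N = y 0%N /\
  forall n,
    [/\ prox tau G (xi n - tau *: Ks (ybar n)) (xi n.+1),
        prox sigma (conjugate H) (y n + sigma *: K (xi n.+1)) (y n.+1) &
        ybar n.+1 = y n.+1 + theta *: (y n.+1 - y n)].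

Section ergodic.
Context {R : realType}.

Definition ergodic_sum (w : R) (N : nat) : R :=
  \sum_(1 <= n < N.+1) (w ^+ n.-1)^-1.

Definition ergodic_mean {V : lmodType R} (w : R) (x : nat -> V) (N : nat) : V :=
  (ergodic_sum w N)^-1 *: \sum_(1 <= n < N.+1) (w ^+ n.-1)^-1 *: x n.

(* (1 - w) / (w (1 - w^N)), extended by its limit 1 / N at w = 1. *)
Definition ergodic_coef (w : R) (N : nat) : R :=
  if w == 1 then N%:R^-1 else (1 - w) / (w * (1 - w ^+ N)).

End ergodic.

(* Main.v *)
Require Import Defs.
From HB Require Import structures.
From mathcomp Require Import all_boot all_order all_algebra.
From mathcomp Require Import all_classical all_reals all_analysis.
From mathcomp Require Import ring lra.

(* Each prox step yields a subgradient, so strong convexity of G and H^* bounds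
   the gap at (xi_n, y_n) by a difference of weighted squared distances plus the
   coupling term <K (xi_{n+1} - x), y_{n+1} - ybar_n>. With
   E_n = |xi_n - x|^2 / (2 tau) + |y_n - v|^2 / (2 sigma)
         + w |y_n - y_{n-1}|^2 / (2 sigma) - w <K (xi_n - x), y_n - y_{n-1}>
   the conditions on w and theta give gap_{n+1} + E_{n+1} / w <= E_n, which
   telescopes to (i); (ii) follows by Jensen's inequality. When G x or H^* v is
   +oo the gap is -oo and there is nothing to prove; in particular properness of
   H^* need not be derived from that of H. *)

Set Implicit Arguments.
Unset Strict Implicit.
Unset Printing Implicit Defensive.

Import Order.TTheory GRing.Theory Num.Theory.
Import numFieldNormedType.Exports.

Local Open Scope classical_set_scope.
Local Open Scope ring_scope.

(** * Inner product algebra and Young's inequality *)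

Section inner_product.
Context {R : realType} {V : finHilbertType R}.
Implicit Types x y z : V.

Lemma innerC x y : inner x y = inner y x.
Proof. by have := hermC (inner : {dot V for _}) x y; rewrite expr0 mul1r. Qed.

Lemma innerDl x y z : inner (x + y) z = inner x z + inner y z.
Proof. by rewrite linearDl. Qed.

Lemma innerDr x y z : inner x (y + z) = inner x y + inner x z.
Proof. by rewrite linearDr. Qed.

Lemma innerNl x z : inner (- x) z = - inner x z.
Proof. by rewrite linearNl. Qed.

Lemma innerNr x z : inner x (- z) = - inner x z.
Proof. by rewrite linearNr. Qed.

Lemma innerZl (a : R) x z : inner (a *: x) z = a * inner x z.
Proof. by rewrite linearZl_LR. Qed.

Lemma innerZr (a : R) x z : inner x (a *: z) = a * inner x z.
Proof. by rewrite innerC innerZl innerC. Qed.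

Definition innerE := (innerDl, innerDr, innerNl, innerNr, innerZl, innerZr).

(** Expand [0 <= |a x - y|^2] and divide by [a]. *)
Lemma young_inner (a : R) x y : 0 < a ->
  2 * inner x y <= a * `|x| ^+ 2 + a^-1 * `|y| ^+ 2.
Proof.
move=> a0; have := sqr_ge0 `|a *: x - y|.
rewrite !sqr_normE !innerE (innerC y x) => h.
rewrite -(ler_pM2l a0) mulrDr (mulrA a a^-1) divff ?gt_eqF// mul1r; lra.
Qed.

End inner_product.

(** * Bounds through the operator norm *)

Lemma opnorm_bound {R : realType} {Z Y : finHilbertType R}
    (K : {linear Z -> Y}) (z : Z) :
  0 < opnorm K -> `|K z| <= opnorm K * `|z|.
Proof.
move=> K0.
(* [sup] is 0 on a set without a supremum, so [0 < opnorm K] forces the image of the unit ball to be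
   bounded. *)
have supK : has_sup [set `|K z| | z in [set z : Z | `|z| <= 1]].
  by apply: contrapT => /sup_out supK; rewrite /opnorm supK ltxx in K0.
have [->|z0] := eqVneq z 0; first by rewrite linear0 !normr0 mulr0.
have nz0 : 0 < `|z| by rewrite normr_gt0.
rewrite -ler_pdivrMr// mulrC.
have -> : `|z|^-1 * `|K z| = `|K (`|z|^-1 *: z)|.
  by rewrite linearZ/= normrZ ger0_norm// invr_ge0.
apply: (ub_le_sup supK.2); exists (`|z|^-1 *: z) => //=.
by rewrite normrZ normfV normr_id mulVf// gt_eqF.
Qed.

Lemma young_operator {R : realType} {Z Y : finHilbertType R}
    (K : {linear Z -> Y}) (a : R) (z : Z) (y : Y) : 0 < a -> 0 < opnorm K ->
  2 * inner (K z) y <= a * opnorm K ^+ 2 * `|z| ^+ 2 + a^-1 * `|y| ^+ 2.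
Proof.
move=> a0 K0; apply: le_trans (young_inner (K z) y a0) _.
rewrite lerD2r -mulrA ler_pM2l// -exprMn lerXn2r ?nnegrE//.
  by rewrite mulr_ge0// ltW.
exact: opnorm_bound.
Qed.

(** * Proximal points, conjugates and Jensen's inequality *)

Section convex_functions.
Context {R : realType} {V : finHilbertType R}.
Implicit Types (F : V -> \bar R) (u v z : V).

Lemma prox_fin_num F (t : R) u v : (forall z, F z != -oo%E) ->
  (exists z, F z != +oo%E) -> prox t F v u -> F u \is a fin_num.
Proof.
move=> FNy [z Fz] /(_ z) /= Fu; rewrite fin_numE FNy /=.
apply/eqP => Fuy; move: Fu Fz (FNy z); rewrite Fuy.
by case: (F z).
Qed.

(** First-order optimality: compare the minimizer [u] with [s z + (1 - s) u], bound [F] there by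
    convexity, divide by [s], and let [s] tend to 0. *)
Lemma prox_subdifferential F (t : R) u v :
  0 < t -> convex_efun F -> (forall z, F z != -oo%E) -> F u \is a fin_num ->
  prox t F v u -> subdifferential F u (t^-1 *: (v - u)).
Proof.
move=> t0 cF FNy /fineK Fu uP z /=.
case Fz: (F z) => [r| |]; last 2 first.
- by rewrite leey.
- by move: (FNy z); rewrite Fz.
rewrite -Fu -EFinD lee_fin.
set f := fine (F u) in Fu *.
set c := (2 * t)^-1 * `|z - u| ^+ 2.
have c0 : 0 <= c by rewrite mulr_ge0// ?sqr_ge0// invr_ge0 mulr_ge0// ltW.
have along_segment s : 0 < s -> s <= 1 ->
    f + inner (t^-1 *: (v - u)) (z - u) <= r + s * c.
  move=> s0 s1.
  have s01 : 0 <= s <= 1 by rewrite (ltW s0).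
  have := le_trans (uP (s *: z + (1 - s) *: u))
    (leeD (cF z u s s01) (lexx _)).
  rewrite -Fu Fz -!EFinM -!EFinD lee_fin => h.
  rewrite -(ler_pM2l s0) /c.
  move: h; rewrite !sqr_normE !innerE (innerC v u) (innerC z u) (innerC z v).
  have -> : (2 * t)^-1 = t^-1 / 2 by rewrite invfM mulrC.
  move: (t^-1) => k; lra.
apply/ler_addgt0Pr => e e0.
(* This [s] stays in the segment and gives [s c <= e]; the added 1 covers [c = 0]. *)
pose s := Num.min 1 (e / (c + 1)).
have s0 : 0 < s by rewrite lt_min ltr01 divr_gt0//; lra.
apply: le_trans (along_segment s s0 _) _; first by rewrite ge_min lexx.
rewrite lerD2l.
have se : s <= e / (c + 1) by rewrite ge_min lexx orbT.
apply: le_trans (ler_wpM2r c0 se) _.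
rewrite mulrAC ler_pdivrMr; last by lra.
by rewrite ler_pM2l//; lra.
Qed.

Lemma prox_strongly_convex F (a t : R) u v z :
  0 < t -> convex_efun F -> strongly_convex a F ->
  (forall z, F z != -oo%E) -> F u \is a fin_num -> F z \is a fin_num ->
  prox t F v u ->
  fine (F u) + inner (t^-1 *: (v - u)) (z - u) + a / 2 * `|z - u| ^+ 2
    <= fine (F z).
Proof.
move=> t0 cF sF FNy Fu /fineK Fz uP.
have := sF u z _ (prox_subdifferential t0 cF FNy Fu uP).
by rewrite -(fineK Fu) -Fz -!EFinD lee_fin.
Qed.

Lemma conjugate_gtNy F p : proper_efun F -> conjugate F p != -oo%E.
Proof.
move=> [FNy [x Fx]]; rewrite -ltNye.
have : ((inner p x)%:E - F x <= conjugate F p)%E.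
  by apply: ereal_sup_ubound; exists x.
apply: lt_le_trans.
by move: Fx (FNy x); case: (F x) => // r _ _; rewrite -EFinB ltNyr.
Qed.

(** For each fixed [x] the map [p |-> <p, x> - F x] is affine or constantly -oo, and the supremum of
    such maps is convex. *)
Lemma convex_conjugate F : (forall x, F x != -oo%E) ->
  convex_efun (conjugate F).
Proof.
move=> FNy p q t /andP[t0 t1]; apply: ge_ereal_sup => _ [x _ <-].
case Fx: (F x) => [r| |]; last 2 first.
- by rewrite leNye.
- by move: (FNy x); rewrite Fx.
have le_conj p' : ((inner p' x - r)%:E <= conjugate F p')%E.
  by rewrite EFinB -Fx; apply: ereal_sup_ubound; exists x.
have t1' : 0 <= 1 - t by rewrite subr_ge0.
apply: le_trans (leeD (lee_wpmul2l _ (le_conj p)) (lee_wpmul2l _ (le_conj q)));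
  rewrite ?lee_fin//.
by rewrite !innerE; lra.
Qed.

(** Jensen by induction: the new mean is a convex combination of the previous mean, with weight
    [S / (S + b)], and the new point. The real bounds [f] keep the right-hand side finite. *)
Lemma convex_mean F (a f : nat -> R) (x : nat -> V) (N : nat) :
  convex_efun F -> (forall n, 0 < a n) -> (0 < N)%N ->
  (forall n, (0 < n)%N -> (F (x n) <= (f n)%:E)%E) ->
  let S := \sum_(1 <= n < N.+1) a n in
  (F (S^-1 *: \sum_(1 <= n < N.+1) a n *: x n)
    <= (S^-1 * \sum_(1 <= n < N.+1) a n * f n)%:E)%E.
Proof.
move=> cF a0 N0 Ff /=; case: N N0 => // N _.
elim: N => [|N IH].
  rewrite !big_nat1 scalerA mulrA mulVf ?gt_eqF// scale1r mul1r.
  exact: Ff.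
rewrite !(big_nat_recr N.+2)//=.
set S := \sum_(1 <= n < N.+2) a n in IH *.
set X := \sum_(1 <= n < N.+2) _ in IH *.
set Q := \sum_(1 <= n < N.+2) _ in IH *.
set b := a N.+2; have b0 : 0 < b by exact: a0.
have S0 : 0 < S by rewrite /S big_nat_recr//= ltr_wpDl// sumr_ge0// => i _; rewrite ltW.
have Sb0 : 0 < S + b by rewrite addr_gt0.
pose t := S / (S + b).
have t01 : 0 <= t <= 1.
  by rewrite /t ler_pdivrMr// mul1r lerDl (ltW b0) divr_ge0// ltW.
have t1 : 1 - t = b / (S + b) by rewrite /t; field; rewrite gt_eqF.
have -> : (S + b)^-1 *: (X + b *: x N.+2) =
    t *: (S^-1 *: X) + (1 - t) *: x N.+2.
  rewrite t1 scalerDr !scalerA; congr (_ *: _ + _ *: _); rewrite /t; field;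
    rewrite ?gt_eqF//.
apply: le_trans (cF _ _ _ t01) _.
have -> : (S + b)^-1 * (Q + b * f N.+2) = t * (S^-1 * Q) + (1 - t) * f N.+2.
  by rewrite t1 /t; field; rewrite ?gt_eqF.
case/andP: t01 => t0 t1'.
rewrite [in leRHS]EFinD [in leRHS]EFinM [X in (_ <= _ + X)%E]EFinM.
by apply: leeD; apply: lee_wpmul2l; rewrite ?lee_fin ?subr_ge0//; exact: Ff.
Qed.

End convex_functions.

(** * Energy of the errors [e], [b] and the dual increment [d], and its decay in one step *)

Definition energy {R : realType} {Z Y : finHilbertType R} (K : {linear Z -> Y})
    (tau sigma w : R) (e : Z) (b d : Y) : R :=
  tau^-1 / 2 * `|e| ^+ 2 + sigma^-1 / 2 * `|b| ^+ 2
  + w * (sigma^-1 / 2 * `|d| ^+ 2 - inner (K e) d).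

Section energy.
Context {R : realType} {Z Y : finHilbertType R} (K : {linear Z -> Y}).
Implicit Types (tau sigma theta w : R) (e : Z) (b d : Y).

(** Young's inequality with weight [sigma] makes the [|d|^2] terms cancel exactly; the loss falls on
    [|e|^2]. *)
Lemma energy_ge tau sigma w e b d : 0 < opnorm K ->
  0 < tau -> 0 < sigma -> 0 < w ->
  (1 - w * opnorm K ^+ 2 * tau * sigma) * (1 / (2 * tau)) * `|e| ^+ 2
    + 1 / (2 * sigma) * `|b| ^+ 2 <= energy K tau sigma w e b d.
Proof.
move=> K0 tau0 sigma0 w0; rewrite /energy.
have := ler_wpM2l (ltW w0) (young_operator e d sigma0 K0).
have -> : (1 - w * opnorm K ^+ 2 * tau * sigma) * (1 / (2 * tau)) =
    tau^-1 / 2 - w * opnorm K ^+ 2 * sigma / 2 by field; rewrite gt_eqF.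
have -> : 1 / (2 * sigma) = sigma^-1 / 2 by field; rewrite gt_eqF.
lra.
Qed.

(* The coupling term theta <K e1, d0> is split as
   w <K e0, d0> + w <K (e1 - e0), d0> + (theta - w) <K e1, d0>: the first part
   belongs to the energy at e0, the second is absorbed by |e1 - e0|^2 and the
   third by the strong convexity of G. *)
Lemma energy_step (gamma delta : R) tau sigma theta w e0 e1 b0 b1 d0 (l : R) :
  0 < opnorm K -> 0 < tau -> 0 < sigma -> 0 < w -> w <= theta ->
  theta * (opnorm K ^+ 2 * tau * sigma) <= 1 ->
  theta + 1 <= w * (tau * gamma + 2) -> 1 <= w * (sigma * delta + 1) ->
  l <= tau^-1 * inner (e0 - e1) e1 + sigma^-1 * inner (b0 - b1) b1
       - gamma / 2 * `|e1| ^+ 2 - delta / 2 * `|b1| ^+ 2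
       + inner (K e1) (b1 - b0 - theta *: d0) ->
  l + w^-1 * energy K tau sigma w e1 b1 (b1 - b0)
    <= energy K tau sigma w e0 b0 d0.
Proof.
move=> K0 tau0 sigma0 w0 wtheta hL hgamma hdelta hl.
set L2 := opnorm K ^+ 2 in hL *.
have L20 : 0 < L2 by rewrite exprn_gt0.
have wn0 : w != 0 by rewrite gt_eqF.
have taun0 : tau != 0 by rewrite gt_eqF.
have sigman0 : sigma != 0 by rewrite gt_eqF.
have L2n0 : L2 != 0 by rewrite gt_eqF.
(* This weight gives [|e1 - e0|^2] the coefficient [tau^-1], matching the square that polarization
   of [<e0 - e1, e1>] leaves over. *)
have a1 : 0 < (L2 * tau)^-1 by rewrite invr_gt0 mulr_gt0.
have Y1 := young_operator (e1 - e0) (- (w *: d0)) a1 K0.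
have a2 : 0 < (L2 * (w * tau))^-1 by rewrite invr_gt0 !mulr_gt0.
have Y2 := young_operator e1 (- d0) a2 K0.
have theta_w : 0 <= theta - w by rewrite subr_ge0.
have {}Y2 := ler_wpM2l theta_w Y2.
(* The [|d0|^2] terms of [Y1] and of the scaled [Y2] have coefficients adding up to
   [w theta L2 tau], hence at most [w sigma^-1]. The next two bounds settle [|e1|^2] and [|b1|^2] in
   the same way. *)
have hL' : theta * L2 * tau <= sigma^-1 by rewrite -div1r ler_pdivlMr//; lra.
have hgamma' : (theta + 1) * (w^-1 * tau^-1) <= gamma + 2 * tau^-1.
  rewrite -(ler_pM2l (mulr_gt0 w0 tau0)).
  have -> : w * tau * ((theta + 1) * (w^-1 * tau^-1)) = theta + 1.
    by field; rewrite taun0 wn0.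
  have -> // : w * tau * (gamma + 2 * tau^-1) = w * (tau * gamma + 2).
    by field.
have hdelta' : w^-1 * sigma^-1 <= sigma^-1 + delta.
  rewrite -(ler_pM2l (mulr_gt0 w0 sigma0)).
  have -> : w * sigma * (w^-1 * sigma^-1) = 1.
    by field; rewrite sigman0 wn0.
  have -> // : w * sigma * (sigma^-1 + delta) = w * (sigma * delta + 1).
    by field.
have F1 := ler_wpM2r (sqr_ge0 `|d0|) (ler_wpM2l (ltW w0) hL').
have F2 := ler_wpM2r (sqr_ge0 `|e1|) hgamma'.
have F3 := ler_wpM2r (sqr_ge0 `|b1|) hdelta'.
move: Y1 Y2 F1 F2 F3 hl.
rewrite /energy [w^-1 * (_ + _)]mulrDr mulKf// -/L2 !invrK.
have -> : (L2 * tau)^-1 * L2 = tau^-1 by field; rewrite taun0.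
have -> : (L2 * (w * tau))^-1 * L2 = w^-1 * tau^-1.
  by field; rewrite taun0 wn0.
rewrite !sqr_normE !linearB/= !innerE (innerC e1 e0) (innerC b1 b0).
(* Multiplying [Y2] by [theta - w] creates [w * w^-1], which has to be cancelled before linear
   arithmetic. *)
have cancel_w : w * w^-1 * tau^-1 * inner e1 e1 = tau^-1 * inner e1 e1.
  by rewrite divff// mul1r.
lra.
Qed.
End energy.

(** Add [w] times the new step to [w] times the induction hypothesis: every old weight gains a
    factor [w], and the new one is [w^(N+1) / w^N = w]. *)
Lemma discounted_sum_le {R : realType} (w : R) (E l : nat -> R) (N : nat) :
  0 < w -> (forall n, l n.+1 + w^-1 * E n.+1 <= E n) ->
  E N + \sum_(1 <= n < N.+1) w ^+ N / w ^+ n.-1 * l n <= w ^+ N * E 0%N.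
Proof.
move=> w0 step; elim: N => [|N IH]; first by rewrite big_geq// addr0 mul1r.
rewrite big_nat_recr//= exprS mulfK ?expf_neq0 ?gt_eqF//.
under eq_bigr do rewrite -!mulrA.
rewrite -mulr_sumr.
under eq_bigr do rewrite mulrA.
have := ler_wpM2l (ltW w0) (step N).
rewrite mulrDr mulVKf ?gt_eqF// => h.
have := ler_wpM2l (ltW w0) IH.
lra.
Qed.

(** * Geometric weights of the averages *)

Section ergodic_weights.
Context {R : realType}.
Implicit Types (w : R) (N : nat).

Lemma ergodic_sum_gt0 w N : 0 < w -> (0 < N)%N -> 0 < ergodic_sum w N.
Proof.
move=> w0; case: N => // N _; rewrite /ergodic_sum big_nat_recr//=.
rewrite ltr_wpDl ?sumr_ge0// => [i _|]; rewrite ?invr_ge0 ?invr_gt0.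
  by rewrite exprn_ge0// ltW.
by rewrite exprn_gt0.
Qed.

Lemma ergodic_sumE w N : 0 < w -> (0 < N)%N ->
  ergodic_sum w N =
  if w == 1 then N%:R else (1 - w ^+ N) / (w ^+ N.-1 * (1 - w)).
Proof.
move=> w0; case: N => // N _; rewrite /ergodic_sum /=.
case: eqVneq => [->|w1].
  elim: N => [|N IH]; first by rewrite big_nat1 expr0 invr1.
  by rewrite big_nat_recr//= IH expr1n invr1 natr1.
have wn0 : w != 0 by rewrite gt_eqF.
have w1' : 1 - w != 0 by rewrite subr_eq0 eq_sym.
elim: N => [|N IH].
  by rewrite big_nat1/= expr0 expr1 mul1r divff// invr1.
rewrite big_nat_recr//= IH !exprS.
have : w ^+ N != 0 by rewrite expf_neq0.
by move: (w ^+ N) => t tn0; field; rewrite wn0 w1' tn0.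
Qed.

(** Identifies the factor in (ii) as the one by which (i) is multiplied to turn its weighted sum
    into a mean. *)
Lemma ergodic_coefE w N : 0 < w <= 1 -> (0 < N)%N ->
  ergodic_coef w N = (w ^+ N * ergodic_sum w N)^-1.
Proof.
move=> /andP[w0 w1] N0; rewrite ergodic_sumE// /ergodic_coef.
case: eqVneq => [->|wn1]; first by rewrite expr1n mul1r.
have wlt1 : w < 1 by rewrite lt_neqAle wn1.
have wN : w ^+ N != 1 by rewrite lt_eqF// exprn_ilt1 ?ltW// -lt0n.
case: N N0 wN => // N _; rewrite exprS/= => wN.
have : w ^+ N != 0 by rewrite expf_neq0 ?gt_eqF.
move: (w ^+ N) wN => t wt tn0; field.
by rewrite tn0 (gt_eqF w0) !subr_eq0 ![1 == _]eq_sym wt wn1.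
Qed.

End ergodic_weights.

(** * The Lagrangian gap along the iterates and at their means *)

Lemma lagrangian_fin {R : realType} {Z Y : finHilbertType R}
    (K : {linear Z -> Y}) (G : Z -> \bar R) (H : Y -> \bar R) x v :
  G x \is a fin_num -> conjugate H v \is a fin_num ->
  lagrangian K G H x v
    = (fine (G x) + inner (K x) v - fine (conjugate H v))%:E.
Proof. by rewrite /lagrangian => /fineK {1}<- /fineK {1}<-. Qed.

Section iterates.
Context {R : realType} {Z Y : finHilbertType R}.
Context (K : {linear Z -> Y}) (Ks : {linear Y -> Z}).
Context (G : Z -> \bar R) (H : Y -> \bar R) (gamma delta tau sigma theta w : R).
Context (xi : nat -> Z) (y ybar : nat -> Y).
Hypotheses (hKs : is_adjoint K Ks) (K0 : 0 < opnorm K).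
Hypotheses (hG : proper_efun G) (cG : convex_efun G) (hH : proper_efun H).
Hypotheses (conjH_proper : exists v, conjugate H v != +oo%E).
Hypotheses (sG : strongly_convex gamma G).
Hypotheses (sH : strongly_convex delta (conjugate H)).
Hypotheses (tau0 : 0 < tau) (sigma0 : 0 < sigma).
Hypotheses (w0 : 0 < w) (w_theta : w <= theta).
Hypotheses (theta_le : theta * (opnorm K ^+ 2 * tau * sigma) <= 1).
Hypotheses (w_gamma : theta + 1 <= w * (tau * gamma + 2)).
Hypotheses (w_delta : 1 <= w * (sigma * delta + 1)).
Hypotheses (halg : primal_dual_iterates K Ks G H tau sigma theta xi y ybar).

(** Index 0 is excluded: the starting points are arbitrary and may lie outside the effective
    domains. *)
Lemma iterates_fin_num n : (0 < n)%N ->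
  G (xi n) \is a fin_num /\ conjugate H (y n) \is a fin_num.
Proof.
case: n => // n _; have [primal dual _] := halg.2 n.
have [GNy Gfin] := hG; split; first exact: prox_fin_num primal.
apply: prox_fin_num dual => // v; exact: conjugate_gtNy.
Qed.

(** Since [0.-1 = 0], the initialization [ybar 0 = y 0] fits the same formula. *)
Lemma overrelaxation n : ybar n = y n + theta *: (y n - y n.-1).
Proof.
case: n => [|n]; first by rewrite halg.1 subrr scaler0 addr0.
by have [_ _ ->] := halg.2 n.
Qed.

(** Real counterpart of the gap. As [fine] sends infinite values to 0, it is meaningful only where
    all four function values are finite. *)
Definition real_gap (x : Z) (v : Y) (n : nat) : R :=
  (fine (G (xi n)) + inner (K (xi n)) v - fine (conjugate H v))
  - (fine (G x) + inner (K x) (y n) - fine (conjugate H (y n))).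

(** The strong convexity inequalities of the two prox steps, tested at [x] and [v], add up to the
    hypothesis of [energy_step] once [Ks] is moved across the inner product. *)
Lemma real_gap_step (x : Z) (v : Y) (n : nat) :
  G x \is a fin_num -> conjugate H v \is a fin_num ->
  let E n := energy K tau sigma w (xi n - x) (y n - v) (y n - y n.-1) in
  real_gap x v n.+1 + w^-1 * E n.+1 <= E n.
Proof.
move=> Gx Hv /=; have [primal dual _] := halg.2 n.
have [G_fin H_fin] := iterates_fin_num (ltn0Sn n).
have conjHNy u : conjugate H u != -oo%E by exact: conjugate_gtNy.
have hp := prox_strongly_convex tau0 cG sG hG.1 G_fin Gx primal.
have hd := prox_strongly_convex sigma0 (convex_conjugate hH.1) sH conjHNy
  H_fin Hv dual.
have diff_y : y n.+1 - y n = (y n.+1 - v) - (y n - v).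
  by rewrite opprB addrA subrK.
rewrite diff_y.
apply: (energy_step (gamma := gamma) (delta := delta) (theta := theta)) => //.
move: hp hd; rewrite /real_gap overrelaxation.
have adjK z u : inner (Ks u) z = inner (K z) u by rewrite innerC -hKs.
rewrite !sqr_normE !linearB/= !innerE !adjK !linearB/= !innerE.
rewrite !(mulrDr sigma^-1 _ (sigma * _)) !mulKf ?gt_eqF//.
rewrite (innerC x (xi n.+1)) (innerC v (y n.+1)); lra.
Qed.

Lemma real_gap_sum_le (x : Z) (v : Y) (N : nat) :
  G x \is a fin_num -> conjugate H v \is a fin_num ->
  (1 - w * opnorm K ^+ 2 * tau * sigma) * (1 / (2 * tau)) * `|xi N - x| ^+ 2
  + 1 / (2 * sigma) * `|y N - v| ^+ 2
  + \sum_(1 <= n < N.+1) w ^+ N / w ^+ n.-1 * real_gap x v n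
  <= w ^+ N / (2 * tau) * `|xi 0%N - x| ^+ 2
     + w ^+ N / (2 * sigma) * `|y 0%N - v| ^+ 2.
Proof.
move=> Gx Hv.
have := discounted_sum_le N w0 (fun n => real_gap_step n Gx Hv).
(* At index 0 the increment [y 0 - y 0.-1] vanishes, so the initial energy has no coupling term. *)
rewrite {2}/energy subrr normr0 expr0n/= mulr0 sub0r.
rewrite linear0r.
have := energy_ge (xi N - x) (y N - v) (y N - y N.-1) K0 tau0 sigma0 w0.
have -> : w ^+ N / (2 * tau) = w ^+ N * (tau^-1 / 2).
  by field; rewrite gt_eqF.
have -> : w ^+ N / (2 * sigma) = w ^+ N * (sigma^-1 / 2).
  by field; rewrite gt_eqF.
lra.
Qed.

Lemma lagrangian_gapE (x : Z) (v : Y) (n : nat) : (0 < n)%N ->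
  G x \is a fin_num -> conjugate H v \is a fin_num ->
  (lagrangian K G H (xi n) v - lagrangian K G H x (y n))%E
    = (real_gap x v n)%:E.
Proof.
by move=> n0 Gx Hv; have [Gn Hn] := iterates_fin_num n0; rewrite !lagrangian_fin.
Qed.

Let weight_gt0 n : 0 < (w ^+ n.-1)^-1.
Proof. by rewrite invr_gt0 exprn_gt0. Qed.

Lemma conjugate_mean_le (N : nat) : (0 < N)%N ->
  (conjugate H (ergodic_mean w y N) <= ((ergodic_sum w N)^-1
    * \sum_(1 <= n < N.+1) (w ^+ n.-1)^-1 * fine (conjugate H (y n)))%:E)%E.
Proof.
move=> N0; apply: (convex_mean (convex_conjugate hH.1) weight_gt0) => // n n0.
by rewrite fineK// (iterates_fin_num n0).2.
Qed.

(** Also serves the case where [G x] is +oo: the Lagrangian at [x] and the dual mean is then +oo and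
    not -oo. *)
Lemma conjugate_mean_fin_num (N : nat) : (0 < N)%N ->
  conjugate H (ergodic_mean w y N) \is a fin_num.
Proof.
move=> /conjugate_mean_le HY.
by rewrite fin_numE conjugate_gtNy// -ltey (le_lt_trans HY) ?ltry.
Qed.

(** Jensen bounds the [G] and conjugate terms at the means, while the bilinear terms average
    exactly. *)
Lemma lagrangian_gap_mean_le (x : Z) (v : Y) (N : nat) : (0 < N)%N ->
  G x \is a fin_num -> conjugate H v \is a fin_num ->
  (lagrangian K G H (ergodic_mean w xi N) v
   - lagrangian K G H x (ergodic_mean w y N)
   <= ((ergodic_sum w N)^-1
       * \sum_(1 <= n < N.+1) (w ^+ n.-1)^-1 * real_gap x v n)%:E)%E.
Proof.
move=> N0 Gx Hv.
have S0 := ergodic_sum_gt0 w0 N0.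
have GX : (G (ergodic_mean w xi N) <= ((ergodic_sum w N)^-1
    * \sum_(1 <= n < N.+1) (w ^+ n.-1)^-1 * fine (G (xi n)))%:E)%E.
  apply: (convex_mean cG weight_gt0) => // n n0.
  by rewrite fineK// (iterates_fin_num n0).1.
have HY := conjugate_mean_le N0.
have GX_fin : G (ergodic_mean w xi N) \is a fin_num.
  by rewrite fin_numE hG.1 -ltey (le_lt_trans GX) ?ltry.
have HY_fin := conjugate_mean_fin_num N0.
rewrite !lagrangian_fin// -EFinB lee_fin.
move: GX HY; rewrite -(fineK GX_fin) -(fineK HY_fin) !lee_fin !fineK//.
set S := ergodic_sum w N in S0 *.
set c := fine (conjugate H v); set d := fine (G x).
have -> : inner (K (ergodic_mean w xi N)) v =
    S^-1 * \sum_(1 <= n < N.+1) (w ^+ n.-1)^-1 * inner (K (xi n)) v.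
  rewrite /ergodic_mean linearZ/= innerZl linear_sum linear_sumlz; congr (_ * _).
  by apply: eq_bigr => n _; rewrite linearZ/= innerZl.
have -> : inner (K x) (ergodic_mean w y N) =
    S^-1 * \sum_(1 <= n < N.+1) (w ^+ n.-1)^-1 * inner (K x) (y n).
  rewrite /ergodic_mean [LHS]innerZr linear_sumr; congr (_ * _).
  by apply: eq_bigr => n _; rewrite [LHS]innerZr.
(* The terms constant in [n] collect the total weight [S], which the normalization removes. *)
have -> : \sum_(1 <= n < N.+1) (w ^+ n.-1)^-1 * real_gap x v n =
    \sum_(1 <= n < N.+1) (w ^+ n.-1)^-1 * fine (G (xi n))
    + \sum_(1 <= n < N.+1) (w ^+ n.-1)^-1 * inner (K (xi n)) v
    - S * (c + d)
    - \sum_(1 <= n < N.+1) (w ^+ n.-1)^-1 * inner (K x) (y n)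
    + \sum_(1 <= n < N.+1) (w ^+ n.-1)^-1 * fine (conjugate H (y n)).
  rewrite /S /ergodic_sum mulr_suml -!sumrN -!big_split/=.
  by apply: eq_bigr => n _; rewrite /real_gap -/c -/d; ring.
have cancel_S : S^-1 * S * (c + d) = c + d by rewrite mulVf ?mul1r ?gt_eqF.
lra.
Qed.

End iterates.

(** * Gaps with infinite values, where -oo absorbs +oo in sums *)

Lemma gap_pinfty_dual {R : realType} {Z Y : finHilbertType R}
    (K : {linear Z -> Y}) (G : Z -> \bar R) (H : Y -> \bar R) a b x v :
  conjugate H v = +oo%E ->
  (lagrangian K G H a v - lagrangian K G H x b)%E = -oo%E.
Proof. by move=> Hv; rewrite /lagrangian Hv /= addeNy addNye. Qed.

(** Finiteness at [b] makes the subtracted Lagrangian +oo; otherwise it would be +oo - +oo, that is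
    -oo. *)
Lemma gap_pinfty_primal {R : realType} {Z Y : finHilbertType R}
    (K : {linear Z -> Y}) (G : Z -> \bar R) (H : Y -> \bar R) a b x v :
  G x = +oo%E -> conjugate H b \is a fin_num ->
  (lagrangian K G H a v - lagrangian K G H x b)%E = -oo%E.
Proof. by rewrite /lagrangian => -> /fineK <- /=; rewrite addeNy. Qed.

Theorem theorem3 (R : realType) (Z Y : finHilbertType R)
  (K : {linear Z -> Y}) (Ks : {linear Y -> Z})
  (G : Z -> \bar R) (H : Y -> \bar R)
  (gamma delta tau sigma theta : R)
  (xis : Z) (ys : Y)
  (xi : nat -> Z) (y ybar : nat -> Y)
  (hKs : is_adjoint K Ks) (hK : 0 < opnorm K)
  (hG : proper_efun G) (cG : convex_efun G) (lG : lower_semicontinuous G)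
  (hH : proper_efun H) (cH : convex_efun H) (lH : lower_semicontinuous H)
  (gamma0 : 0 < gamma) (delta0 : 0 < delta)
  (sG : strongly_convex gamma G)
  (sH : strongly_convex delta (conjugate H))
  (hsad : saddle_point (lagrangian K G H) xis ys)
  (tau0 : 0 < tau) (sigma0 : 0 < sigma) (theta01 : 0 < theta <= 1)
  (htheta : Num.max (1 / (tau * gamma + 1)) (1 / (sigma * delta + 1)) <= theta
            <= 1 / (opnorm K ^+ 2 * tau * sigma))
  (halg : primal_dual_iterates K Ks G H tau sigma theta xi y ybar)
  (w : R)
  (hw : Num.max ((theta + 1) / (tau * gamma + 2)) (1 / (sigma * delta + 1))
        <= w <= theta) :
  (forall (N : nat) (x : Z) (v : Y),
    (((1 - w * opnorm K ^+ 2 * tau * sigma) * (1 / (2 * tau))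
        * `|xi N - x| ^+ 2
      + 1 / (2 * sigma) * `|y N - v| ^+ 2)%:E
     + \sum_(1 <= n < N.+1) (w ^+ N / w ^+ n.-1)%:E
         * (lagrangian K G H (xi n) v - lagrangian K G H x (y n))
     <= (w ^+ N / (2 * tau) * `|xi 0%N - x| ^+ 2
         + w ^+ N / (2 * sigma) * `|y 0%N - v| ^+ 2)%:E)%E)
  /\
  (forall N : nat, (1 <= N)%N ->
    ergodic_sum w N
      = (if w == 1 then N%:R else (1 - w ^+ N) / (w ^+ N.-1 * (1 - w)))
    /\
    forall (x : Z) (v : Y),
      ((ergodic_coef w N * (1 - w * opnorm K ^+ 2 * tau * sigma)
          * (1 / (2 * tau)) * `|x - xi N| ^+ 2
        + ergodic_coef w N * (1 / (2 * sigma)) * `|v - y N| ^+ 2)%:E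
       + (lagrangian K G H (ergodic_mean w xi N) v
          - lagrangian K G H x (ergodic_mean w y N))
       <= ((ergodic_sum w N)^-1 * (1 / (2 * tau)) * `|x - xi 0%N| ^+ 2
           + (ergodic_sum w N)^-1 * (1 / (2 * sigma)) * `|v - y 0%N| ^+ 2)%:E)%E).
Proof.
have [tau_gamma sigma_delta] : 0 < tau * gamma /\ 0 < sigma * delta.
  by rewrite !mulr_gt0.
case/andP: hw; rewrite ge_max => /andP[w_gamma w_delta] w_theta.
have w0 : 0 < w by apply: lt_le_trans w_delta; rewrite divr_gt0//; lra.
have w1 : w <= 1 by case/andP: theta01 => _; exact: le_trans.
rewrite ler_pdivrMr in w_gamma; last by lra.
rewrite ler_pdivrMr in w_delta; last by lra.
have theta_le : theta * (opnorm K ^+ 2 * tau * sigma) <= 1.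
  by case/andP: htheta => _; rewrite ler_pdivlMr// !mulr_gt0// exprn_gt0.
have conj_fin v : conjugate H v != +oo%E -> conjugate H v \is a fin_num.
  by rewrite fin_numE conjugate_gtNy.
(* The test point [v] itself witnesses that the conjugate is not identically +oo. *)
have iter_fin v n : conjugate H v != +oo%E -> (0 < n)%N ->
    G (xi n) \is a fin_num /\ conjugate H (y n) \is a fin_num.
  by move=> Hv; apply: iterates_fin_num halg n => //; exists v.
split=> [N x v|N N0].
- have gap_infty :
      (forall n, (0 < n)%N ->
        (lagrangian K G H (xi n) v - lagrangian K G H x (y n) = -oo)%E) ->
      ((((1 - w * opnorm K ^+ 2 * tau * sigma) * (1 / (2 * tau))
        * `|xi N - x| ^+ 2 + 1 / (2 * sigma) * `|y N - v| ^+ 2)%:E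
      + \sum_(1 <= n < N.+1) (w ^+ N / w ^+ n.-1)%:E
         * (lagrangian K G H (xi n) v - lagrangian K G H x (y n))
      <= (w ^+ N / (2 * tau) * `|xi 0%N - x| ^+ 2
         + w ^+ N / (2 * sigma) * `|y 0%N - v| ^+ 2)%:E)%E).
    case: N => [_|N gapNy].
      (* For [N = 0] the sum is empty and no -oo helps; the claim reduces to
         [1 - w L^2 tau sigma <= 1]. *)
      rewrite big_geq// adde0 lee_fin expr0 lerD2r.
      apply: ler_wpM2r; first exact: sqr_ge0.
      apply: ler_piMl; first by rewrite divr_ge0// mulr_ge0// ltW.
      by rewrite gerBl !mulr_ge0 ?sqr_ge0// ltW.
    rewrite big_nat_recr//= gapNy// gt0_muleNy; last first.
      by rewrite lte_fin divr_gt0 ?exprn_gt0.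
    by rewrite !addeNy leNye.
  have [Hv|Hv] := eqVneq (conjugate H v) +oo%E.
    by apply: gap_infty => n _; exact: gap_pinfty_dual.
  have [Gx|Gx] := eqVneq (G x) +oo%E.
    apply: gap_infty => n n0; apply: gap_pinfty_primal => //.
    exact: (iter_fin v n Hv n0).2.
  have Gx_fin : G x \is a fin_num by rewrite fin_numE hG.1.
  have Hv_fin := conj_fin v Hv.
  rewrite (_ : (\sum_(1 <= n < N.+1) _)%E = (\sum_(1 <= n < N.+1)
      w ^+ N / w ^+ n.-1 * real_gap K G H xi y x v n)%:E); last first.
    rewrite -sumEFin; apply: eq_big_nat => n /andP[n0 _].
    rewrite [RHS]EFinM; congr (_ * _)%E.
    by apply: lagrangian_gapE halg _ _ _ _ _ _ => //; exists v.
  rewrite -EFinD lee_fin.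
  apply: (real_gap_sum_le hKs _ _ _ _ _ sG sH) halg _ _ _ _ _ => //; by exists v.
split=> [|x v]; first exact: ergodic_sumE.
have [Hv|Hv] := eqVneq (conjugate H v) +oo%E.
  by rewrite gap_pinfty_dual// addeNy leNye.
have Hp : exists v, conjugate H v != +oo%E by exists v.
have [Gx|Gx] := eqVneq (G x) +oo%E.
  rewrite gap_pinfty_primal// ?addeNy ?leNye//.
  exact: (conjugate_mean_fin_num hG hH Hp w0 halg).
have Gx_fin : G x \is a fin_num by rewrite fin_numE hG.1.
have Hv_fin := conj_fin v Hv.
have gap_le := lagrangian_gap_mean_le hG cG hH Hp w0 halg N0 Gx_fin Hv_fin.
(* It remains to multiply the real form of (i) by [c = (w^N S)^-1], for which [c w^N = S^-1]. *)
apply: le_trans (leeD2l _ gap_le) _.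
rewrite -EFinD lee_fin !(distrC x) !(distrC v).
have := real_gap_sum_le hKs hK hG cG hH Hp sG sH tau0 sigma0 w0 w_theta
  theta_le w_gamma w_delta halg N Gx_fin Hv_fin.
under eq_bigr do rewrite -mulrA.
rewrite -mulr_sumr ergodic_coefE ?w0//.
have S0 := ergodic_sum_gt0 w0 N0.
have wN0 : 0 < w ^+ N by rewrite exprn_gt0.
set S := ergodic_sum w N in S0 *; set c := (_ * S)^-1.
have c0 : 0 <= c by rewrite invr_ge0 mulr_ge0 ?ltW.
have -> : S^-1 = c * w ^+ N by rewrite /c; field; rewrite !gt_eqF.
move=> /(ler_wpM2l c0); lra.
Qed.
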